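(* Let $\alpha$ be a countably infinite successor ordinal and let $u\in\mathcal{P}_\alpha$. Then there exists a function $f:\omega\to\omega$ such that: (1) for every integer $n\ge1$ and every $U\in f^{n-1}(u)$, $f^n$ restricted to $U$ is not finite-to-one (where $f^0$ is the identity, so $f^0(u)=u$, and $f^n$ is the $n$-fold composition); (2) the sequence $(f^n)_{n<\omega}$ converges pointwise (i.e., for each $k<\omega$ the sequence $(f^n(k))_n$ is eventually constant); (3) $f^n(u)\in\mathcal{P}_\alpha$ for every $n<\omega$, and $g(u)\in\mathcal{P}_\alpha$ where $g=\lim_{n<\omega}f^n$ is the pointwise limit.
   Context: For $f:\omega\to\omega$ and a filter $p$ on $\omega$, $f(p)=\{B: f^{-1}(B)\in p\}$. A filter on $A\subseteq\omega$ is identified with the filter on $\omega$ it generates. A cascade is a tree $V$ without infinite branches and with least element $\emptyset_V$; $v^+$ is the set of immediate successors of $v$, $v^\uparrow$ the subcascade of $v$ and everything above it. $V$ is sequential if each non-maximal $v$ has $v^+$ countably infinite. Ranks: $r(v)=0$ for maximal $v$, otherwise the least ordinal greater than all $r(w)$, $w\in v^+$; $r(V)=r(\emptyset_V)$. Monotone: each $v^+$ can be enumerated $(v_k)$ with non-decreasing ranks. The contour $\int V$ is the filter on $\max V$: principal at $v$ for maximal $v$; otherwise $\int v^\uparrow=\{A: A\cap \max v_k^\uparrow\in\int v_k^\uparrow$ for all but finitely many $k\}$; $\int V=\int\emptyset_V^\uparrow$. A monotone sequential contour of rank $\alpha$ is $\int V$ for a monotone sequential cascade $V$ of rank $\alpha$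 with $\max V\subseteq\omega$. For $1\le\alpha<\omega_1$, $\mathcal{P}_\alpha$ is the class of ultrafilters on $\omega$ containing no monotone sequential contour of rank $\alpha$ but one of each rank $1\le\beta<\alpha$. *)

(* Defs.v *)
From HB Require Import structures.
From mathcomp Require Import all_boot all_order.
From mathcomp Require Import all_classical.

Set Implicit Arguments.
Unset Strict Implicit.
Unset Printing Implicit Defensive.

Import Order.Theory.
Local Open Scope classical_set_scope.

(* Notations for ordinals below omega_1: every such ordinal is either 0 or the
   least ordinal strictly above the terms of some sequence of smaller ordinals.
   Several notations may denote the same ordinal, so equality of ordinals is
   [oeq], not Leibniz equality. *)
Inductive cord : Type :=
| ozero : cord
| olsup : (nat -> cord) -> cord.

(* olsup s <= olsup t iff s n < olsup t for all n, iff for all n there is m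
   with s n <= t m. *)
Fixpoint ole (a b : cord) {struct a} : Prop :=
  match a, b with
  | ozero, _ => True
  | olsup _, ozero => False
  | olsup s, olsup t => forall n, exists m, ole (s n) (t m)
  end.

Definition osucc (a : cord) : cord := olsup (fun=> a).
Definition olt (a b : cord) : Prop := ole (osucc a) b.
Definition oeq (a b : cord) : Prop := ole a b /\ ole b a.

Definition oone : cord := osucc ozero.
Definition oomega : cord := olsup (fun n => iter n osucc ozero).

Definition branch d (V : porderType d) (B : set V) : Prop :=
  total_on B (fun x y => (x <= y)%O) /\
  forall C : set V, B `<=` C -> total_on C (fun x y => (x <= y)%O) -> C = B.

Record cascade := Cascade {
  cascade_disp : Order.disp_t;
  node :> bPOrderType cascade_disp;
  (* tree: the predecessors of each node are well-ordered *)
  cascade_tree : forall (v : node) (A : set node),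
    A !=set0 -> (forall w, A w -> (w <= v)%O) ->
    exists2 m, A m & forall w, A w -> (m <= w)%O;
  cascade_branch : forall B : set node, branch B -> finite_set B
}.

Section Cascades.
Variable V : cascade.

Definition leaf (v : V) : Prop := forall w : V, (v <= w)%O -> w = v.

(* v^+ *)
Definition succs (v : V) : set V :=
  [set w | (v < w)%O /\ forall x : V, ~ ((v < x)%O /\ (x < w)%O)].

(* max v^\uparrow *)
Definition leaves_above (v : V) : set V := [set w | (v <= w)%O /\ leaf w].

Definition sequential : Prop :=
  forall v : V, ~ leaf v -> (succs v #= [set: nat])%card.

(* In a sequential cascade all ranks are countable, so values in [cord] suffice;
   the rank function is determined up to [oeq]. *)
Definition is_rank (r : V -> cord) : Prop :=
  (forall v, leaf v -> oeq (r v) ozero) /\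
  (forall v, ~ leaf v ->
     (forall w, succs v w -> olt (r w) (r v)) /\
     (forall a, (forall w, succs v w -> olt (r w) a) -> ole (r v) a)).

Definition monotone_wrt (r : V -> cord) : Prop :=
  forall v : V, ~ leaf v -> exists e : nat -> V,
    set_bij [set: nat] (succs v) e /\
    (forall i j, (i <= j)%N -> ole (r (e i)) (r (e j))).

(* [contour v A] says that A \cap max v^\uparrow belongs to the contour of
   v^\uparrow. As cascades have no infinite branches, this inductive predicate is
   the definition by recursion along the tree; F is the finite set of
   exceptional successors. *)
Inductive contour : V -> set V -> Prop :=
| contour_leaf v (A : set V) : leaf v -> A v -> contour v A
| contour_node v (A F : set V) :
    ~ leaf v -> finite_set F ->
    (forall w, succs v w -> ~ F w -> contour w (A `&` leaves_above w)) ->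
    contour v A.

End Cascades.

(* F is (the filter on omega generated by) a monotone sequential contour of rank
   a. The inclusion of max V in omega is given by [lab], which is injective on
   max V; its values at the other nodes play no role. *)
Definition mono_seq_contour (a : cord) (F : set_system nat) : Prop :=
  exists (V : cascade) (r : V -> cord) (lab : V -> nat),
    [/\ sequential V, is_rank r, monotone_wrt r & oeq (r \bot%O) a] /\
    set_inj (@leaf V) lab /\
    F = [set B | contour \bot%O (lab @^-1` B `&` leaves_above \bot%O)].

Definition P_class (a : cord) (u : set_system nat) : Prop :=
  [/\ UltraFilter u,
      ~ (exists F, mono_seq_contour a F /\ F `<=` u)
    & forall b, ole oone b -> olt b a ->
        exists F, mono_seq_contour b F /\ F `<=` u].

Definition finite_to_one_on (U : set nat) (f : nat -> nat) : Prop :=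
  forall m, finite_set (U `&` f @^-1` [set m]).

Definition ptws_limit (F : nat -> nat -> nat) (g : nat -> nat) : Prop :=
  forall k, \forall n \near \oo, F n k = g k.

(* Main.v *)
(* Let alpha = beta + 1 and let V be a monotone sequential cascade of rank
   beta >= omega with contour in u. After shrinking the contour, the nodes of V of
   rank omega have uniform branches of finite unbounded heights d. Name the nodes
   of these branches by integers outside some member of u, and let f move each
   leaf, and each named node, to its immediate predecessor, until depth d/2 is
   reached. Then f^n (resp. its limit g) cuts the branches at depth
   max(d - n, d/2) (resp. d/2); these depths are still unbounded, so the image
   cascade has rank beta and its contour is in the image of u. Lower ranks follow
   since a contour of rank beta contains contours of all smaller ranks, and no
   image of u contains a contour of rank alpha since such a contour pulls back to
   u. In every branch of height > 2n, f still collapses a whole family of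
   siblings at step n, so it is not finite-to-one on any member of f^n(u). *)

Require Import Defs.
From HB Require Import structures.
From mathcomp Require Import all_boot all_order.
From mathcomp Require Import all_classical.
From mathcomp Require Import zify.

Set Implicit Arguments.
Unset Strict Implicit.
Unset Printing Implicit Defensive.

Import Order.Theory.
Local Open Scope classical_set_scope.

(** * Ordinal notations *)

Lemma ole_refl a : ole a a.
Proof. by elim: a => [|s IH] //= n; exists n. Qed.

Lemma ole_trans b a c : ole a b -> ole b c -> ole a c.
Proof.
elim: a b c => [|s IH] [|t] [|v] //= st tv n.
have [m sm] := st n; have [p tp] := tv m.
by exists p; apply: IH sm tp.
Qed.

Lemma olt_olsup (s : nat -> cord) n : olt (s n) (olsup s).
Proof. by move=> _; exists n; apply: ole_refl. Qed.

Lemma olt_olsupP a (s : nat -> cord) : olt a (olsup s) <-> exists n, ole a (s n).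
Proof. by split=> [/(_ 0)|an _]. Qed.

Lemma olsup_le (s : nat -> cord) a : (forall n, olt (s n) a) -> ole (olsup s) a.
Proof. by case: a => [/(_ 0)|t st n] //; have /olt_olsupP := st n. Qed.

Lemma olsup_mono (s t : nat -> cord) :
  (forall n, exists m, ole (s n) (t m)) -> ole (olsup s) (olsup t).
Proof. by []. Qed.

Lemma olt_le_trans b a c : olt a b -> ole b c -> olt a c.
Proof. exact: ole_trans. Qed.

Lemma ole_lt_trans b a c : ole a b -> olt b c -> olt a c.
Proof. by move=> ab; apply: ole_trans => _; exists 0. Qed.

Lemma ole_succ a : ole a (osucc a).
Proof. elim: a => [|s IH] //= n; exists 0; exact: (ole_trans (IH n) (olt_olsup s n)). Qed.

Lemma oltW a b : olt a b -> ole a b.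
Proof. exact: ole_trans (ole_succ a). Qed.

Lemma ole_or_lt a b : ole a b \/ olt b a.
Proof.
elim: a b => [|s IH] b; first by left.
case: b => [|t]; first by right=> _; exists 0.
have [st|/existsNP[n /forallNP sn]] := pselect (forall n, exists m, ole (s n) (t m)).
  by left.
right; apply/olt_olsupP; exists n; apply: olsup_le => m.
by have [/sn|] := IH n (t m).
Qed.

Lemma olt_wf : well_founded olt.
Proof.
(* Strengthened to all [b] below [a], because distinct terms may denote the same ordinal and a
   smaller ordinal need not occur literally inside [a]. *)
suff acc a b : ole b a -> Acc olt b by move=> a; apply/acc/ole_refl.
elim: a b => [|s IH] b ba; constructor=> c cb.
  by have := olt_le_trans cb ba.
by have /olt_olsupP[n /IH] := olt_le_trans cb ba.
Qed.

Lemma olt_irrefl a : ~ olt a a.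
Proof. by elim: (olt_wf a) => b _ IH bb; apply: (IH b bb bb). Qed.

Lemma oeq_sym a b : oeq a b -> oeq b a.
Proof. by case. Qed.

Lemma oeq_trans b a c : oeq a b -> oeq b c -> oeq a c.
Proof.
by move=> [ab ba] [bc cb]; split; [apply: ole_trans ab bc|apply: ole_trans cb ba].
Qed.

(** * From cascades to labelled trees and back *)

(* A node carries the enumeration of its immediate successors; only the leaves
   are labelled. *)
Inductive tree := Leaf of nat | Node of (nat -> tree).

Fixpoint rk (T : tree) : cord :=
  if T is Node t then olsup (fun k => rk (t k)) else ozero.

Fixpoint supp (T : tree) : set nat :=
  match T with
  | Leaf x => [set x]
  | Node t => [set x | exists k, supp (t k) x]
  end.

Fixpoint ctr (T : tree) (A : set nat) : Prop :=
  match T with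
  | Leaf x => A x
  | Node t => exists N, forall k, N <= k -> ctr (t k) A
  end.

Fixpoint mono_tree (T : tree) : Prop :=
  match T with
  | Leaf _ => True
  | Node t => [/\ forall k, mono_tree (t k),
      forall i j x, supp (t i) x -> supp (t j) x -> i = j
    & forall i j, i <= j -> ole (rk (t i)) (rk (t j))]
  end.

Definition has_contour (a : cord) (u : set_system nat) : Prop :=
  exists T, [/\ mono_tree T, oeq (rk T) a & forall A, ctr T A -> u A].

Section FromCascade.
Variables (V : cascade) (r : V -> cord) (lab : V -> nat).
Hypotheses (rV : is_rank r) (mV : monotone_wrt r) (labV : set_inj (@leaf V) lab).

(** Predecessors of [x] are well-ordered, so [w] and [w'] are comparable; an immediate successor of
    [v] cannot lie strictly above another one. *)
Lemma succs_below (v w w' x : V) : succs v w -> succs v w' ->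
  (w <= x)%O -> (w' <= x)%O -> w = w'.
Proof.
move=> [vw nw] [vw' nw'] wx w'x.
have [||m] := @cascade_tree V x [set w; w'].
- by exists w; left.
- by move=> y [->|->].
move=> mw mle; have mw1 := mle w (or_introl erefl); have mw2 := mle w' (or_intror erefl).
case: mw => /= mE; subst m.
- move: mw2; rewrite le_eqVlt => /predU1P[//|ww'].
  by case: (nw' w).
- move: mw1; rewrite le_eqVlt => /predU1P[//|ww'].
  by case: (nw w').
Qed.

Lemma tree_of_cascade (v : V) : exists T, [/\ mono_tree T, oeq (rk T) (r v),
   forall x, supp T x -> exists2 w, leaves_above v w & lab w = x
 & forall B, ctr T B -> contour v (lab @^-1` B `&` leaves_above v)].
Proof.
(* The induction runs along the rank, which strictly drops from a node to its successors. *)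
have [a [av acc]] : exists a, r v = a /\ Acc olt a.
  by exists (r v); exact: conj erefl (olt_wf _).
elim: acc v av => {}a _ IH v av.
have [vl|vn] := pselect (leaf v).
  exists (Leaf (lab v)); split=> //=.
  - exact/oeq_sym/(rV.1 v vl).
  - by move=> x ->; exists v.
  - by move=> B Bv; apply: contour_leaf.
have [e [[esucc einj esurj] emono]] := mV vn.
have {}esucc k : succs v (e k) by apply: esucc.
have [rlt rmin] := rV.2 v vn.
have /choice[t tP] k := IH (r (e k)) ltac:(rewrite -av; exact: rlt (esucc k)) (e k) erefl.
have lv k w : leaves_above (e k) w -> leaves_above v w.
  by case=> ew wl; split=> //; apply: le_trans ew; have [/ltW] := esucc k.
exists (Node t); split => /=.
- split=> [k|i j x|i j ij]; first by have [] := tP k.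
  + have [_ _ + _] := tP i => /[apply] -[w lw <-].
    have [_ _ + _] := tP j => /[apply] -[w' lw' ww'].
    have E : w = w' by apply: labV => //; rewrite inE; [case: lw|case: lw'].
    subst w'; apply: einj; rewrite ?inE //.
    exact: succs_below (esucc i) (esucc j) lw.1 lw'.1.
  + have [_ [ti _] _ _] := tP i; have [_ [_ tj] _ _] := tP j.
    exact: ole_trans ti (ole_trans (emono _ _ ij) tj).
- split.
  + apply: olsup_le => k; have [_ [tk _] _ _] := tP k.
    exact: ole_lt_trans tk (rlt _ (esucc k)).
  + apply: rmin => w /esurj[k _ <-]; have [_ [_ tk] _ _] := tP k.
    by apply/olt_olsupP; exists k.
- move=> x [k]; have [_ _ + _] := tP k => /[apply] -[w lw <-].
  by exists w => //; apply: lv lw.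
- move=> B [N BN]; apply: (@contour_node _ _ _ (e @` `I_N)) => //.
    exact/finite_image/finite_II.
  move=> w /esurj[k _ <-] /= nk.
  have Nk : N <= k by rewrite leqNgt; apply/negP => kN; apply: nk; exists k.
  have [_ _ _ /(_ B (BN k Nk))] := tP k.
  congr contour; apply/seteqP; split=> x /=.
    by move=> [Bx lx]; split=> //; split=> //; apply: lv lx.
  by move=> [[Bx _] lx].
Qed.

End FromCascade.

Lemma has_contour_of_mono a u :
  (exists F, mono_seq_contour a F /\ F `<=` u) -> has_contour a u.
Proof.
move=> [F [[V [r [lab [[_ rV mV ra] [labV ->]]]]] Fu]].
have [T [Tw Tr _ TB]] := tree_of_cascade rV mV labV \bot%O.
exists T; split=> //; first exact: oeq_trans Tr ra.
by move=> A /TB; apply: Fu.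
Qed.

(** * Addresses in a labelled tree as the nodes of a cascade *)

Fixpoint addr (T : tree) (s : seq nat) : bool :=
  match T, s with
  | _, [::] => true
  | Leaf _, _ => false
  | Node t, k :: s' => addr (t k) s'
  end.

Fixpoint subtree (T : tree) (s : seq nat) : tree :=
  match T, s with
  | Node t, k :: s' => subtree (t k) s'
  | _, _ => T
  end.

Definition is_node (T : tree) : bool := if T is Node _ then true else false.
Definition child (T : tree) (k : nat) : tree := if T is Node t then t k else T.
Definition leaf_label (T : tree) : nat := if T is Leaf x then x else 0.

Lemma addr_cat T s s' : addr T (s ++ s') -> addr T s.
Proof. by elim: s T => [[]|k s IH] //= [x|t] //= /IH. Qed.

Lemma addr_rcons T s k : addr T (rcons s k) = addr T s && is_node (subtree T s).
Proof. by elim: s T => [|j s IH] [x|t] //=; case: (t k). Qed.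

Lemma subtree_rcons T s k : addr T s -> subtree T (rcons s k) = child (subtree T s) k.
Proof. by elim: s T => [|j s IH] [x|t] //= => [_|/IH//]; case: (t k). Qed.

Lemma subtree_supp T s x : addr T s -> subtree T s = Leaf x -> supp T x.
Proof.
elim: s T => [|k s IH] [y|t] //= => [_ [->]//|sk /IH]; first by exists k; auto.
Qed.

Lemma subtree_inj T s s' x : mono_tree T -> addr T s -> addr T s' ->
  subtree T s = Leaf x -> subtree T s' = Leaf x -> s = s'.
Proof.
elim: s s' T => [|k s IH] [|k' s'] [y|t] //= [wt dis _] sk sk' E E'.
have kk' : k = k' by apply: dis (subtree_supp sk E) (subtree_supp sk' E').
by subst k'; rewrite (IH _ _ (wt k) sk sk' E E').
Qed.

Definition anode (T : tree) := {s : seq nat | addr T s}.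

Section AddressOrder.
Variable T : tree.
HB.instance Definition _ := Choice.on (anode T).

Definition anode_le (v w : anode T) : bool := prefix (val v) (val w).

Fact anode_refl : reflexive anode_le.
Proof. by move=> v; apply: prefix_refl. Qed.

Fact anode_anti : antisymmetric anode_le.
Proof.
move=> v w /andP[/prefixP[s sE] /prefixP[s' s'E]]; apply: val_inj.
move: s'E; rewrite sE -catA -{1}(cats0 (val v)) => /eqP.
rewrite eqseq_cat // eqxx /=; case: s sE => [|//]; by rewrite cats0.
Qed.

Fact anode_trans : transitive anode_le.
Proof. by move=> w v x; apply: prefix_trans. Qed.

Fact anode_display : Order.disp_t. Proof. exact: (Order.Disp tt tt). Qed.

HB.instance Definition _ := Order.isPOrder.Build anode_display (anode T)
  (fun _ _ => erefl) anode_refl anode_anti anode_trans.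

Fact addr_nil : addr T [::]. Proof. by case: T. Qed.
Definition aroot : anode T := exist _ [::] addr_nil.
End AddressOrder.

HB.instance Definition _ T := @Order.hasBottom.Build anode_display (anode T)
  (aroot T) (fun v => prefix0s (val v)).

Lemma anode_leE T (v w : anode T) : (v <= w)%O = prefix (val v) (val w).
Proof. by []. Qed.

Lemma anode_ltE T (v w : anode T) : (v < w)%O = (val v != val w) && prefix (val v) (val w).
Proof. by rewrite lt_neqAle. Qed.

Lemma anode_tree T (v : anode T) (A : set (anode T)) :
  A !=set0 -> (forall w, A w -> (w <= v)%O) ->
  exists2 m, A m & forall w, A w -> (m <= w)%O.
Proof.
move=> [w0 Aw0] Av.
pose P n := `[< exists2 w, A w & size (val w) = n >].
have exP : exists n, P n by exists (size (val w0)); apply/asboolP; exists w0.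
case: (ex_minnP exP) => n /asboolP[m Am mn] nmin; exists m => // w Aw; rewrite anode_leE.
have mw : size (val m) <= size (val w).
  by rewrite mn; apply: nmin; apply/asboolP; exists w.
have := Av _ Am; have := Av _ Aw; rewrite !anode_leE !prefixE => /eqP wE /eqP mE.
by rewrite -wE take_takel // mE.
Qed.

(** Induction on [T]: in a chain all nonempty addresses start with the same index, and deleting it
    leaves a chain of addresses in a single child. *)
Lemma addr_chain_finite T (B : set (seq nat)) : (forall s, B s -> addr T s) ->
  total_on B (fun s s' => prefix s s') -> finite_set B.
Proof.
elim: T B => [x|t IH] B Ba Bt.
  by apply: (@sub_finite_set _ _ [set [::]]) => // s /Ba; case: s.
have [[k [s0 Bs0]]|nB] := pselect (exists k s, B (k :: s)); last first.
  apply: (@sub_finite_set _ _ [set [::]]) => // -[//|k s Bs].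
  by case: nB; exists k, s.
apply: (@sub_finite_set _ _ ([set [::]] `|` (cons k @` [set s | B (k :: s)]))).
  move=> [|j s] Bs; [by left|right].
  have jk : j = k by have [] := Bt _ _ Bs Bs0; rewrite prefix_cons => /andP[/eqP].
  by subst j; exists s.
rewrite finite_setU; split=> //; apply/finite_image/(IH k).
  by move=> s /Ba.
by move=> s s' Bs Bs'; have := Bt _ _ Bs Bs'; rewrite !prefix_cons eqxx.
Qed.

Lemma anode_branch_finite T (B : set (anode T)) : branch B -> finite_set B.
Proof.
move=> [Bt _]; have : finite_set (val @` B).
  apply: (@addr_chain_finite T) => [_ [v _ <-]|_ _ [v Bv <-] [w Bw <-]].
    exact: valP.
  exact: Bt.
move=> /(finite_preimage (f := val : anode T -> seq nat) (in2W val_inj)).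

by apply: (@sub_finite_set (anode T)) => v Bv; exists v.
Qed.

Definition tree_cascade (T : tree) : cascade :=
  @Cascade anode_display (anode T) (@anode_tree T) (@anode_branch_finite T).

Section ToCascade.
Variables (T : tree) (wT : mono_tree T).
Local Notation V := (tree_cascade T).

Definition anode_subtree (v : V) : tree := subtree T (val (v : anode T)).

Lemma anode_succ (v w : V) k :
  val (w : anode T) = rcons (val (v : anode T)) k -> succs v w.
Proof.
move=> wE; split=> [|x [vx xw]].
  rewrite anode_ltE wE prefix_rcons andbT; apply/eqP => /(congr1 size).
  by rewrite size_rcons => /n_Sn.
move: vx xw; rewrite !anode_ltE wE => /andP[+ /prefixP[s xE]].
rewrite xE; case: s xE => [|j s] xE; first by rewrite cats0 eqxx.
move=> _ /andP[xw /prefixP[s2 E]]; have := congr1 size E.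
rewrite size_rcons !size_cat /= -addnA -{1}(addn1 (size _)) => /addnI/esym.
rewrite addSn => -[] /eqP; rewrite addn_eq0 => /andP[_ /nilP s20].
by rewrite {}E s20 cats0 eqxx in xw.
Qed.

Lemma anode_child (v : V) k : ~~ is_node (anode_subtree v) \/
  exists2 w : V, val (w : anode T) = rcons (val (v : anode T)) k &
     anode_subtree w = child (anode_subtree v) k.
Proof.
have [nv|nv] := boolP (is_node (anode_subtree v)); last by left.
have vk : addr T (rcons (val (v : anode T)) k) by rewrite addr_rcons (valP (v : anode T)).
right; exists (exist (fun s => addr T s) _ vk : anode T) => //.
by rewrite /anode_subtree /= subtree_rcons // (valP (v : anode T)).
Qed.

Lemma anode_ltP (v w : V) : (v < w)%O ->
  is_node (anode_subtree v) /\ exists k s, val (w : anode T) = rcons (val (v : anode T)) k ++ s.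
Proof.
rewrite anode_ltE => /andP[+ /prefixP[s wE]].
case: s wE => [|k s] wE; first by rewrite wE cats0 eqxx.
rewrite -cat_rcons in wE => _; split; last by exists k, s.
have := valP (w : anode T); rewrite wE => /addr_cat.
by rewrite addr_rcons => /andP[].
Qed.

Lemma anode_leafP (v : V) : leaf v <-> ~~ is_node (anode_subtree v).
Proof.
split=> [vl|nv w].
  have [//|[w wE _]] := anode_child v 0.
  have [vw _] := anode_succ wE.
  by have := vl w (ltW vw) => wv; rewrite wv ltxx in vw.
by rewrite le_eqVlt => /predU1P[->//|/anode_ltP[]]; rewrite (negbTE nv).
Qed.

Lemma anode_succP (v w : V) : succs v w ->
  exists2 k, val (w : anode T) = rcons (val (v : anode T)) k &
     anode_subtree w = child (anode_subtree v) k.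
Proof.
move=> [vw nvw]; have [nv [k [s wE]]] := anode_ltP vw.
have [|[x xE xs]] := anode_child v k; first by rewrite nv.
have [vx _] := anode_succ xE.
suff -> : w = x by exists k.
have xw : (x <= w)%O by rewrite anode_leE wE xE prefix_prefix.
by move: xw; rewrite le_eqVlt => /predU1P[//|xw]; case: (nvw x).
Qed.

Lemma anode_nodeP (v : V) : ~ leaf v -> exists2 t, anode_subtree v = Node t &
  exists e : nat -> V, [/\ forall k, anode_subtree (e k) = t k,
    forall k, val (e k : anode T) = rcons (val (v : anode T)) k
  & set_bij [set: nat] (succs v) e].
Proof.
move=> vn; case E : (anode_subtree v) => [x|t].
  by case: vn; apply/anode_leafP; rewrite E.
exists t => //.
have /choice[e eP] k : exists w : V, val (w : anode T) = rcons (val (v : anode T)) k /\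
     anode_subtree w = t k.
  by have [|[w wE wt]] := anode_child v k; [rewrite E|exists w; rewrite wt E].
exists e; split=> [k|k|]; [by case: (eP k)|by case: (eP k)|split].
- by move=> k _; have [/anode_succ] := eP k.
- move=> i j _ _ eij; have [] := eP i; rewrite eij; have [-> _] := eP j.
  by move=> /rcons_inj[].
- move=> w /anode_succP[k wk _]; exists k => //; apply: val_inj => /=.
  by have [] := eP k; rewrite wk.
Qed.

Lemma tree_sequential : sequential V.
Proof.
move=> v /anode_nodeP[t _ [e [_ _ [es einj esurj]]]].
have -> : succs v = e @` setT by apply/seteqP; split=> [w /esurj//|_ [k _ <-]]; apply: es.
exact: inj_card_eq.
Qed.

Lemma tree_rank : is_rank (fun v : V => rk (anode_subtree v)).
Proof.
split=> v.
  by move=> /anode_leafP; case: (anode_subtree v).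
move=> /anode_nodeP[t vt [e [et _ [esucc _ esurj]]]]; split=> [w /esurj[k _ <-]|a ra].
  by rewrite et vt; apply: olt_olsup.
by rewrite vt; apply: olsup_le => k; rewrite -et; apply/ra/esucc.
Qed.

Lemma mono_subtree s : mono_tree (subtree T s).
Proof.
by elim: s T wT => [|k s IH] [x|t] //= [wt _ _]; apply: IH.
Qed.

Lemma tree_monotone : monotone_wrt (fun v : V => rk (anode_subtree v)).
Proof.
move=> v /anode_nodeP[t vt [e [et _ eb]]]; exists e; split=> // i j ij.
have := mono_subtree (val (v : anode T)); rewrite -/(anode_subtree v) vt => -[_ _ m].
by rewrite !et; apply: m.
Qed.

Definition tree_label (v : V) : nat := leaf_label (anode_subtree v).

Lemma tree_label_inj : set_inj (@leaf V) tree_label.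
Proof.
move=> v w; rewrite !inE => /anode_leafP vl /anode_leafP wl.
rewrite /tree_label; case vE: (anode_subtree v) vl => [x|//] _.
case wE: (anode_subtree w) wl => [y|//] _ /= xy; subst y.
by apply: val_inj; apply: (subtree_inj wT) vE wE; apply: valP.
Qed.

Lemma ctr_of_contour (T' : tree) (v : V) (A : set V) (B : set nat) :
  anode_subtree v = T' -> contour v A -> (forall w, A w -> B (tree_label w)) ->
  ctr T' B.
Proof.
elim: T' v A => [x|t IH] v A vT c AB.
  have vl : leaf v by apply/anode_leafP; rewrite vT.
  case: c AB vT vl => {v A} [v A _ Av AB vT _|//].
  by have := AB v Av; rewrite /tree_label vT.
have vn : ~ leaf v by move=> /anode_leafP; rewrite vT.
case: c vn vT AB => {v A} [//|v A F _ /finite_seqP[f fE] cw].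
move=> /anode_nodeP[t' -> [e [et ev [es _ _]]]] [tt] AB.
(* The address of [e k] ends in [k], so past the largest last entry found in the finite set [F] no
   [e k] is exceptional. *)
subst t'; exists (\max_(x <- f) last 0 (val (x : anode T))).+1 => k fk.
have nF : ~ F (e k).
  rewrite fE /= => ef; move: fk; rewrite ltnNge => /negP; apply.
  rewrite -[leqLHS](last_rcons 0 (val (v : anode T))) -ev.
  exact: (@leq_bigmax_seq (anode T) f xpredT (fun x : anode T => last 0 (val x)) _ ef).
by apply: IH (et k) (cw (e k) (es k I) nF) _ => w [/AB].
Qed.

Lemma tree_mono_seq_contour : exists2 F, mono_seq_contour (rk T) F &
  forall A, F A -> ctr T A.
Proof.
exists [set B | contour (\bot%O : V) (tree_label @^-1` B `&` leaves_above \bot%O)].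
  exists V, (fun v => rk (anode_subtree v)), tree_label; split; last first.
    by split=> //; apply: tree_label_inj.
  split; [exact: tree_sequential|exact: tree_rank|exact: tree_monotone|].
  by rewrite /anode_subtree /=; case: (T); split; apply: ole_refl.
move=> A cA; apply: (ctr_of_contour _ cA) => [|w []//].
by rewrite /anode_subtree /=; case: (T).
Qed.

End ToCascade.

Lemma mono_seq_contour_eq a b F : oeq a b -> mono_seq_contour a F -> mono_seq_contour b F.
Proof.
move=> ab [V [r [lab [[sV rV mV ra] rest]]]]; exists V, r, lab; split=> //; split=> //.
exact: oeq_trans ra ab.
Qed.

Lemma mono_of_has_contour a u :
  has_contour a u -> exists F, mono_seq_contour a F /\ F `<=` u.
Proof.
move=> [T [wT Ta Tu]]; have [F TF FT] := tree_mono_seq_contour wT.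
by exists F; split; [exact: mono_seq_contour_eq TF|move=> A /FT /Tu].
Qed.

(** Lets the rest of the argument work with labelled trees alone. *)
Lemma P_classP a u : P_class a u <-> [/\ UltraFilter u, ~ has_contour a u
  & forall b, ole oone b -> olt b a -> has_contour b u].
Proof.
split=> -[uu na ub]; split=> //.
- by move=> /mono_of_has_contour.
- by move=> b b1 ba; apply/has_contour_of_mono/ub.
- by move=> /has_contour_of_mono.
- by move=> b b1 ba; apply/mono_of_has_contour/ub.
Qed.

(** * Contours of smaller rank and images of ultrafilters *)

Lemma finite_eventually (I : choiceType) (F : set I) (P : I -> nat -> Prop) : finite_set F ->
  (forall x, F x -> exists N, forall k, N <= k -> P x k) ->
  exists N, forall k, N <= k -> forall x, F x -> P x k.
Proof.
move=> /finite_seqP[s ->]; elim: s => [_|x s IH Fx]; first by exists 0 => k _ x /=; rewrite in_nil.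
have [|N NP] := IH; first by move=> y /= ys; apply: Fx; rewrite /= inE ys orbT.
have [|M MP] := Fx x; first by rewrite /= inE eqxx.
exists (maxn N M) => k; rewrite geq_max => /andP[Nk Mk] y /=.
by rewrite inE => /predU1P[->|]; [apply: MP|apply: NP].
Qed.

Lemma supp_nonempty T : exists x, supp T x.
Proof. by elim: T => [x|t /(_ 0)[x tx]] /=; [exists x|exists x, 0]. Qed.

Lemma supp_eventually t x : mono_tree (Node t) ->
  exists N, forall k, N <= k -> ~ supp (t k) x.
Proof.
move=> [_ dis _]; have [[j jx]|nx] := pselect (exists j, supp (t j) x).
  by exists j.+1 => k jk kx; rewrite (dis _ _ _ jx kx) ltnn in jk.
by exists 0 => k _ kx; apply: nx; exists k.
Qed.

Lemma supp_infinite T : mono_tree T -> is_node T -> infinite_set (supp T).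
Proof.
case: T => [//|t] wT _ fT.
have [N NP] := finite_eventually fT (fun x _ => supp_eventually x wT).
by have [x tx] := supp_nonempty (t N); apply: (NP N (leqnn _) x) => //; exists N.
Qed.

Lemma ctr_supp T A : supp T `<=` A -> ctr T A.
Proof.
elim: T => [x|t IH] /= tA; first exact: tA.
by exists 0 => k _; apply: IH => x kx; apply: tA; exists k.
Qed.

(** Each of the finitely many missing points lies below at most one child, so almost all children
    have their whole support in [A]. *)
Lemma ctr_cofinite T A : mono_tree T -> is_node T ->
  finite_set (supp T `\` A) -> ctr T A.
Proof.
case: T => [//|t] wT _ fA.
have [N NP] := finite_eventually fA (fun x _ => supp_eventually x wT).
exists N => k Nk; apply: ctr_supp => x kx; apply: contrapT => nA.
by apply: (NP k Nk x) => //; split=> //; exists k.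
Qed.

(** For injective [e], the cofinite filter on the range of [e], as a tree of rank 1. *)
Definition frechet (e : nat -> nat) := Node (fun k => Leaf (e k)).

Lemma frechet_mono e : injective e -> mono_tree (frechet e).
Proof. by move=> ei; split=> // i j x /= -> /ei. Qed.

Lemma ctr_frechet e A : ctr (frechet e) A -> finite_set (range e `\` A).
Proof.
move=> [N NP]; apply: (@sub_finite_set _ _ (e @` `I_N)); last exact/finite_image/finite_II.
move=> _ [[k _ <-] nA]; exists k => //=; rewrite ltnNge; apply/negP => Nk.
exact/nA/NP.
Qed.

Lemma infinite_enum (S : set nat) : infinite_set S ->
  exists2 e : nat -> nat, injective e & range e = S.
Proof.
move=> Si; have : ([set: nat] #= S)%card by rewrite card_eq_sym; apply: eq_card_nat.
move=> /card_set_bijP[e [eS ei es]]; exists e; first by move=> i j; apply: ei; rewrite inE.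
by apply/seteqP; split=> [_ [k _ <-]|x /es[k _ <-]]; [apply: eS|exists k].
Qed.

Lemma ole1P a : ole oone a \/ ole a ozero.
Proof. by case: a => [|s]; [right|left=> _; exists 0]. Qed.

Lemma rk_node T : is_node T <-> ole oone (rk T).
Proof. by case: T => [x|t] //=; split=> // /(_ 0)[]. Qed.

Lemma bounded_max (s : nat -> cord) (P : nat -> Prop) K : exists c : cord,
  (c = ozero \/ exists n, [/\ n <= K, P n & c = s n]) /\
  forall n, n <= K -> P n -> ole (s n) c.
Proof.
elim: K => [|K [c [cE cmax]]].
  have [P0|nP0] := pselect (P 0).
    exists (s 0); split; first by right; exists 0.
    by move=> n; rewrite leqn0 => /eqP-> _; apply: ole_refl.
  by exists ozero; split; [left|move=> n; rewrite leqn0 => /eqP->].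
have cE' : c = ozero \/ exists n, [/\ n <= K.+1, P n & c = s n].
  by case: cE => [->|[n [nK Pn ->]]]; [left|right; exists n; rewrite leqW].
have [PK|nPK] := pselect (P K.+1); last first.
  exists c; split=> // n; rewrite leq_eqVlt => /predU1P[->//|]; exact: cmax.
have [sc|cs] := ole_or_lt (s K.+1) c.
  by exists c; split=> // n; rewrite leq_eqVlt => /predU1P[->//|]; exact: cmax.
exists (s K.+1); split; first by right; exists K.+1.
move=> n; rewrite leq_eqVlt => /predU1P[-> _|nK Pn]; first exact: ole_refl.
exact: ole_trans (cmax _ nK Pn) (oltW cs).
Qed.

(** Children are shrunk recursively to non-decreasing ranks whose successors have supremum [b]. Rank
    1 is treated apart, by the cofinite filter on the whole support, since a child must keep rank at
    least 1 for its contour to stay inside the old one. *)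
Lemma tree_lower T b : mono_tree T -> ole b (rk T) -> exists T',
  [/\ mono_tree T', oeq (rk T') b, supp T' `<=` supp T
   & ole oone b -> forall A, ctr T' A -> ctr T A].
Proof.
elim: T b => [y|t IH] b wT bT.
  by exists (Leaf y); split.
have [b1|b0] := ole1P b; last first.
  have [x tx] := supp_nonempty (Node t); exists (Leaf x); split=> //.
  - by move=> _ ->.
  - by move=> b1; have := ole_trans b1 b0.
have [ble|blt] := ole_or_lt b oone.
  have [e ei eS] := infinite_enum (supp_infinite wT isT).
  exists (frechet e); split=> [||x [k ->]|_ A /ctr_frechet].
  - exact: frechet_mono.
  - by split; [apply: ole_trans b1|apply: ole_trans ble _] => _; exists 0.
  - by rewrite -eS; exists k.
  - by rewrite eS; apply: ctr_cofinite.
case: b b1 bT blt => [//|s] b1 bT /olt_olsupP[n0 sn0].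
have [wt dis tm] := wT.
(* [c k] is the largest [s n] with [n <= k] that fits below the rank of [t k]; since these ranks are
   monotone, so is [c], and every [s n] is eventually reached. *)
have /choice[c cP] k := bounded_max s (fun n => ole (s n) (rk (t k))) k.
have ct k : ole (c k) (rk (t k)) by have [[->//|[n [_ ? ->]]]] := cP k.
have /choice[t' tP] k := IH k (c k) (wt k) (ct k).
have cs n : exists K, forall k, K <= k -> ole (s n) (c k).
  have [m sm] := bT n; exists (maxn n m) => k; rewrite geq_max => /andP[nk mk].
  by apply: (cP k).2 => //; apply: ole_trans sm (tm _ _ mk).
exists (Node t'); split=> /=.
- split=> [k|i j x|i j ij].
  + by have [] := tP k.
  + have [_ _ si _] := tP i; have [_ _ sj _] := tP j.
    by move=> /si + /sj; apply: dis.
  + have [_ [rci _] _ _] := tP i; have [_ [_ rcj] _ _] := tP j.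
    apply: ole_trans rci (ole_trans _ rcj).
    have [[->//|[n [ni sn ->]]] _] := cP i.
    by apply: (cP j).2; [apply: leq_trans ij|apply: ole_trans sn (tm _ _ ij)].
- split.
  + apply: olsup_le => k; have [_ [rck _] _ _] := tP k.
    apply: ole_lt_trans rck _.
    by have [[->|[n [_ _ ->]]] _] := cP k; [exact: b1|exact: olt_olsup].
  + move=> n; have [K KP] := cs n; exists K; have [_ [_ rck] _ _] := tP K.
    exact: ole_trans (KP K (leqnn _)) rck.
- by move=> x [k]; have [_ _ sk _] := tP k => /sk tx; exists k.
- move=> _ A [N NP]; have [K KP] := cs n0; exists (maxn N K) => k.
  rewrite geq_max => /andP[Nk Kk]; have [_ _ _ sub] := tP k.
  by apply: sub (NP k Nk); apply: ole_trans sn0 (KP k Kk).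
Qed.

Lemma has_contour_le a b u : ole oone b -> ole b a -> has_contour a u -> has_contour b u.
Proof.
move=> b1 ba [T [wT [_ aT] Tu]].
have [T' [wT' Tb _ sub]] := tree_lower wT (ole_trans ba aT).
by exists T'; split=> // A /(sub b1) /Tu.
Qed.

(* The leaves below a node of rank 1 are replaced by all their preimages. A
   set meeting almost all of the enlarged families in finite sets has an image
   with the same property. *)
Lemma tree_preimage (h : nat -> nat) T : (forall y, exists x, h x = y) -> mono_tree T ->
  exists T', [/\ mono_tree T', oeq (rk T') (rk T), supp T' `<=` h @^-1` supp T
   & is_node T -> forall A, ctr T' A -> ctr T [set y | forall x, h x = y -> A x]].
Proof.
move=> hs; elim: T => [y|t IH] wT.
  have [x xy] := hs y; by exists (Leaf x); split=> // _ ->.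
(* Once one child is a node, monotonicity makes all later ones nodes and the recursion applies to
   them; otherwise the tree has rank 1. *)
have [[k0 k0P]|nk] := pselect (exists k, is_node (t k)).
  have [wt dis tm] := wT.
  have /choice[t' tP] k := IH k (wt k).
  exists (Node t'); split=> /=.
  - split=> [k|i j x|i j ij].
    + by have [] := tP k.
    + have [_ _ si _] := tP i; have [_ _ sj _] := tP j.
      by move=> /si + /sj; apply: dis.
    + have [_ [ri _] _ _] := tP i; have [_ [_ rj] _ _] := tP j.
      exact: ole_trans ri (ole_trans (tm _ _ ij) rj).
  - by split=> k; exists k; have [_ [? ?] _ _] := tP k.
  - by move=> x [k]; have [_ _ sk _] := tP k => /sk tx; exists k.
  - move=> _ A [N NP]; exists (maxn N k0) => k.
    rewrite geq_max => /andP[Nk kk]; have [_ _ _ sub] := tP k.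
    apply: sub (NP k Nk); apply/rk_node.
    exact: ole_trans ((rk_node _).1 k0P) (tm _ _ kk).
have hi : infinite_set (h @^-1` supp (Node t)).
  move=> /(finite_image h) fh; apply: (supp_infinite wT isT).
  apply: sub_finite_set fh => y ty; have [x xy] := hs y.
  by exists x => //; rewrite /preimage /= xy.
have [e ei eS] := infinite_enum hi.
exists (frechet e); split.
- exact: frechet_mono.
- have rt k : ole (rk (t k)) ozero.
    by case E: (t k) => // [u]; case: nk; exists k; rewrite E.
  split; apply: olsup_mono => k; exists k; first by [].
  exact: rt.
- by move=> x [k ->]; rewrite -eS; exists k.
- move=> _ A /ctr_frechet; rewrite eS => /(finite_image h) fA.
  apply: ctr_cofinite => //; apply: sub_finite_set fA => y [ty /existsNP[x /not_implyP[xy nA]]].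
  by exists x => //; split=> //; rewrite /preimage /= xy.
Qed.

Lemma ultra_sub (u : set_system nat) (A B C : set nat) : UltraFilter u ->
  u A -> u B -> (forall x, A x -> B x -> C x) -> u C.
Proof.
move=> uu uA uB ABC; have pu : ProperFilter u := @ultra_proper _ _ uu.
by apply: filterS (filterI uA uB) => x [Ax Bx]; apply: ABC.
Qed.

Lemma ultra_disjoint (u : set_system nat) (A B : set nat) : UltraFilter u ->
  u A -> u B -> (forall x, A x -> ~ B x) -> False.
Proof.
move=> uu uA uB AB; have pu : ProperFilter u := @ultra_proper _ _ uu.
exact: (@filter_not_empty _ u pu (ultra_sub uu uA uB AB)).
Qed.

(** If [A] is in the pulled-back contour but its complement is in [u], then the set of [y] whose
    fibre lies in [A] belongs to the image of [u], while its preimage misses that complement. *)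
Lemma has_contour_fmap_surj a (h : nat -> nat) u : UltraFilter u ->
  (forall y, exists x, h x = y) -> ole oone a ->
  has_contour a (fmap h u) -> has_contour a u.
Proof.
move=> uu hs a1 [T [wT Ta Tu]]; have [T' [wT' TT _ sub]] := tree_preimage hs wT.
exists T'; split=> //; first exact: oeq_trans TT Ta.
move=> A A'.
have [//|nA] := in_ultra_setVsetC (F := u) A uu; exfalso.
have hA := Tu _ (sub ((rk_node T).2 (ole_trans a1 Ta.2)) A A').
by apply: ultra_disjoint uu nA hA _ => x nAx /(_ x erefl).
Qed.

Definition parity (e : bool) : set nat := [set x | odd x = e].

(* Redefining h on a set outside u makes it surjective. *)
Lemma has_contour_fmap a (h : nat -> nat) u e : UltraFilter u -> ~ u (parity e) ->
  ole oone a -> has_contour a (fmap h u) -> has_contour a u.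
Proof.
move=> uu ue a1 [T [wT Ta Tu]].
pose h' x := if odd x == e then x./2 else h x.
apply: (@has_contour_fmap_surj _ h') => //.
  move=> y; exists (e + y.*2); rewrite /h' oddD odd_double addbF.
  by case: (e) => /=; rewrite ?uphalf_double ?doubleK.
exists T; split=> // A /Tu hA.
have [//|ne] := in_ultra_setVsetC (F := u) (parity e) uu.
apply: ultra_sub uu ne hA _ => x /eqP/negbTE nx hx.
by rewrite /preimage /= /h' nx.
Qed.

(** The parity class outside [u] is the reservoir of integers used to name inner nodes. *)
Lemma ultra_parity u : UltraFilter u -> exists e, ~ u (parity e).
Proof.
move=> uu; have [uT|] := pselect (u (parity true)); last by exists true.
by exists false => uF; apply: ultra_disjoint uu uT uF _ => x; rewrite /parity /= => ->.
Qed.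

(** * Cascades with uniform branches *)

Definition ofin (n : nat) : cord := iter n osucc ozero.

Lemma ofin_le m n : m <= n -> ole (ofin m) (ofin n).
Proof.
elim: m n => [|m IH] [|n] // mn.
by apply: (@olsup_mono (fun=> ofin m) (fun=> ofin n)) => _; exists 0; apply: IH.
Qed.

Lemma ofin_lt_omega n : olt (ofin n) oomega.
Proof. exact: (olt_olsup (fun n => ofin n)). Qed.

Lemma omega_le a : (forall n, ole (ofin n) a) -> ole oomega a.
Proof. by move=> na; apply: olsup_le => n; apply: (na n.+1). Qed.

Lemma ofin_floor a : ~ ole oomega a ->
  exists n, ole (ofin n) a /\ olt a (ofin n.+1).
Proof.
move=> aw; have exn : exists n, `[< ~ ole (ofin n) a >].
  have [/omega_le//|/existsNP[n na]] := pselect (forall n, ole (ofin n) a).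
  by exists n; apply/asboolP.
case: (ex_minnP exn) => -[/asboolP[]//|n /asboolP na nmin]; exists n; split.
  apply: contrapT => nn; have := nmin n; rewrite ltnn => nmin'.
  by have := nmin' (introT (asboolP _) nn).
by have [/na|] := ole_or_lt (ofin n.+1) a.
Qed.

(** Its contour is the image under [l] of the [d]-fold Fubini power of the cofinite filter. *)
Fixpoint unif (d : nat) (l : seq nat -> nat) : tree :=
  if d is d'.+1 then Node (fun i => unif d' (fun s => l (i :: s))) else Leaf (l [::]).

Lemma unif_supp d l x : supp (unif d l) x -> exists2 s, size s = d & l s = x.
Proof.
elim: d l => [|d IH] l /=; first by move=> ->; exists [::].
by move=> [i /IH[s <- <-]]; exists (i :: s).
Qed.

Lemma unif_rk d l : rk (unif d l) = ofin d.
Proof. by elim: d l => [|d IH] l //=; congr olsup; apply: funext. Qed.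

Lemma unif_mono d l :
  (forall s s', size s = d -> size s' = d -> l s = l s' -> s = s') ->
  mono_tree (unif d l).
Proof.
elim: d l => [|d IH] l li //=; split=> [i|i j x|i j _].
- by apply: IH => s s' sd s'd /li; rewrite /= sd s'd => /(_ erefl erefl)[].
- move=> /unif_supp[s sd <-] /unif_supp[s' s'd] /li.
  by rewrite /= sd s'd => /(_ erefl erefl)[].
- by rewrite !unif_rk; apply: ole_refl.
Qed.

Lemma eq_unif d l l' : (forall s, size s = d -> l s = l' s) -> unif d l = unif d l'.
Proof.
elim: d l l' => [|d IH] l l' ll' /=; first by rewrite ll'.
by congr Node; apply: funext => i; apply: IH => s sd; apply: ll'; rewrite /= sd.
Qed.

Lemma ctr_unif_take d' d l' l A B : d' <= d ->
  (forall s, size s = d -> A (l' (take d' s)) -> B (l s)) ->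
  ctr (unif d' l') A -> ctr (unif d l) B.
Proof.
elim: d' d l' l => [|d' IH] d l' l.
  by move=> _ AB Al; apply: ctr_supp => _ /unif_supp[s sd <-]; apply: AB; rewrite ?take0.
case: d => // d dd AB /= [N NP]; exists N => i /NP; apply: IH => // s sd.
by apply: (AB (i :: s)); rewrite /= sd.
Qed.

(** Only level [q] matters: below it every child is taken, at it almost every child, and above it
    all leaves lie in [A]. *)
Lemma ctr_unif_level q r l A :
  (forall s, size s = q -> exists N, forall i, N <= i ->
     forall s', size s' = r -> A (l (s ++ i :: s'))) ->
  ctr (unif (q + r.+1) l) A.
Proof.
elim: q l => [|q IH] l H.
  have [N NP] := H [::] erefl; exists N => i Ni.
  by apply: ctr_supp => _ /unif_supp[s sr <-]; apply: (NP i Ni s).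
exists 0 => j _; apply: IH => s sq; apply: (H (j :: s)); by rewrite /= sq.
Qed.

(** Early children of too small rank are dropped and the others shrunk recursively, down to cofinite
    filters on whole supports. Height 0 is excluded because a principal filter is not contained in
    the contour of a node. *)
Lemma tree_unif d T : mono_tree T -> ole (ofin d.+1) (rk T) -> exists l,
  [/\ forall s s', size s = d.+1 -> size s' = d.+1 -> l s = l s' -> s = s',
      forall s, size s = d.+1 -> supp T (l s)
    & forall A, ctr (unif d.+1 l) A -> ctr T A].
Proof.
elim: d T => [|d IH] T wT dT.
  have nT : is_node T by apply/rk_node.
  have [e ei eS] := infinite_enum (supp_infinite wT nT).
  exists (fun s => e (head 0 s)); split=> [[|i []]// [|j []]// _ _ /ei /= -> //|s _|A].
    by rewrite -eS; eexists.
  by move=> /(@ctr_frechet e); rewrite eS; apply: ctr_cofinite.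
case: T wT dT => [//|t] wT dT.
have [m dm] : exists m, ole (ofin d.+1) (rk (t m)) := dT 0.
have [wt dis tm] := wT.
have /choice[l lP] k := IH (t (m + k)) (wt _) (ole_trans dm (tm _ _ (leq_addr k m))).
exists (fun s => l (head 0 s) (behead s)); split.
- move=> [//|i s] [//|j s'] /= [sd] [s'd] E; have [li lS _] := lP i.
  have ij : i = j.
    apply/(@addnI m)/dis; first exact: lS sd.
    by rewrite E; have [_ lS' _] := lP j; apply: lS'.
  by subst j; rewrite (li s s').
- by move=> [//|i s] /= [sd]; have [_ lS _] := lP i; exists (m + i); apply: lS.
- move=> A [N NP]; exists (m + N) => k mk.
  have [_ _] := lP (k - m); rewrite subnKC; last by lia.
  by apply; apply: NP; lia.
Qed.

(* [Om d l] stands for a cascade of rank omega whose k-th branch is uniform of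
   height [d k], with leaf labels [l k s], s ranging over the lists of length
   [d k]. *)
Inductive itree :=
| Om of (nat -> nat) & (nat -> seq nat -> nat)
| INode of (nat -> itree).

Fixpoint irk (W : itree) : cord :=
  match W with
  | Om _ _ => oomega
  | INode w => olsup (fun j => irk (w j))
  end.

Fixpoint occ (W : itree) (d : nat -> nat) (l : nat -> seq nat -> nat) : Prop :=
  match W with
  | Om d' l' => d' = d /\ l' = l
  | INode w => exists j, occ (w j) d l
  end.

Definition isupp (W : itree) : set nat :=
  [set x | exists d l k s, [/\ occ W d l, size s = d k & l k s = x]].

Fixpoint wf_itree (W : itree) : Prop :=
  match W with
  | Om d l => [/\ forall i j, i <= j -> d i <= d j, forall n, exists k, n <= d k,
       forall k, 0 < d k
     & forall k k' s s', size s = d k -> size s' = d k' -> l k s = l k' s' ->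
         k = k' /\ s = s']
  | INode w => [/\ forall j, wf_itree (w j),
       forall i j x, isupp (w i) x -> isupp (w j) x -> i = j
     & forall i j, i <= j -> ole (irk (w i)) (irk (w j))]
  end.

Lemma occ_wf W d l : wf_itree W -> occ W d l -> wf_itree (Om d l).
Proof.
elim: W => [d' l' wf [<- <-]|w IH [wf _ _] [j oj]]; first exact: wf.
exact: IH (wf j) oj.
Qed.

(** Leaf labels are distinct, so a label determines its node of rank omega, its branch and its
    address; this makes the coding by [height] and [trunc] well defined. *)
Lemma occ_inj W d l d' l' k k' s s' : wf_itree W -> occ W d l -> occ W d' l' ->
  size s = d k -> size s' = d' k' -> l k s = l' k' s' ->
  [/\ d = d', l = l', k = k' & s = s'].
Proof.
elim: W => [d0 l0 [_ _ _ li] [<- <-] [<- <-] sk sk' E|w IH [wf dis _] [i oi] [j oj] sk sk' E].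
  by have [] := li _ _ _ _ sk sk' E.
have ij : i = j.
  by apply: (dis i j (l k s)); [exists d, l, k, s|exists d', l', k', s'].
by subst j; apply: IH (wf i) oi oj sk sk' E.
Qed.

(** In a uniform branch of height [n], the address of the leftmost leaf above the node [s]. *)
Definition pad (n : nat) (s : seq nat) : seq nat := s ++ nseq (n - size s) 0.

Lemma pad_size n s : size s = n -> pad n s = s.
Proof. by move=> <-; rewrite /pad subnn cats0. Qed.

Lemma size_pad n s : size s <= n -> size (pad n s) = n.
Proof. by move=> sn; rewrite size_cat size_nseq subnKC. Qed.

Lemma take_pad m n s : m <= size s -> take m (pad n s) = take m s.
Proof. exact: takel_cat. Qed.

Lemma pad_inj n s s' : size s = size s' -> pad n s = pad n s' -> s = s'.
Proof.
move=> ss E; have := congr1 (take (size s)) E.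
by rewrite take_pad // take_pad ?ss // -{1}ss !take_size.
Qed.

(* Branches of height d of [W] are cut at depth [D d]; a new leaf is labelled
   by the h-image of the label of the leftmost old leaf above it. *)
Fixpoint cut (D : nat -> nat) (h : nat -> nat) (W : itree) : tree :=
  match W with
  | Om d l => Node (fun k => unif (D (d k)) (fun s => h (l k (pad (d k) s))))
  | INode w => Node (fun j => cut D h (w j))
  end.

(** Both [D] and the heights are unbounded, so the cut heights are too and nodes of rank omega keep
    their rank. Labels stay distinct because padding is injective on addresses of equal length. *)
Lemma cut_mono (D h : nat -> nat) W : {homo D : m n / m <= n} -> (forall n, D n <= n) ->
  (forall n, exists m, n <= D m) -> injective h -> wf_itree W ->
  [/\ mono_tree (cut D h W), oeq (rk (cut D h W)) (irk W)
    & forall x, supp (cut D h W) x -> exists2 y, isupp W y & h y = x].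
Proof.
move=> Dm Dle Dub hi; elim: W => [d l [dm dub dpos li]|w IH [wf dis wm]].
  have sup k x : supp (unif (D (d k)) (fun s => h (l k (pad (d k) s)))) x ->
      exists2 s, size s = d k & h (l k s) = x.
    move=> /unif_supp[s sd <-]; exists (pad (d k) s) => //.
    by rewrite size_pad // sd.
  split=> /=.
  - split=> [k|i j x|i j ij].
    + apply: unif_mono => s s' sd s'd /hi /li[]; try by rewrite size_pad // ?sd ?s'd.
      by move=> _ /pad_inj; apply; rewrite sd.
    + move=> /sup[s sd <-] /sup[s' s'd /hi E]; by have [] := li _ _ _ _ s'd sd E.
    + by rewrite !unif_rk; apply/ofin_le/Dm/dm.
  - split; first by apply: olsup_le => k; rewrite unif_rk; apply: ofin_lt_omega.
    move=> n; have [m nm] := Dub n; have [k mk] := dub m; exists k.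
    rewrite unif_rk; apply: ofin_le; apply: leq_trans nm (Dm _ _ mk).
  - by move=> x [k /sup[s sd <-]]; exists (l k s) => //; exists d, l, k, s.
split=> /=.
- split=> [k|i j x|i j ij].
  + by have [] := IH k (wf k).
  + have [_ _ /[apply] -[y yi <-]] := IH i (wf i).
    by have [_ _ /[apply] -[y' y'j /hi E]] := IH j (wf j); subst y'; apply: dis yi y'j.
  + have [_ [ri _] _] := IH i (wf i); have [_ [_ rj] _] := IH j (wf j).
    exact: ole_trans ri (ole_trans (wm _ _ ij) rj).
- by split; apply: olsup_mono => j; exists j; have [_ [? ?] _] := IH j (wf j).
- move=> x [j]; have [_ _ /[apply] -[y [d [l [k [s [o sd lE]]]]] <-]] := IH j (wf j).
  by exists y => //; exists d, l, k, s; split=> //; exists j.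
Qed.

Lemma ctr_cut_id W A : (forall d l, occ W d l -> exists N, forall k, N <= k ->
   ctr (unif (d k) (l k)) A) -> ctr (cut id id W) A.
Proof.
elim: W => [d l H|w IH H] /=.
  have [|N NP] := H d l; first by [].
  exists N => k /NP; congr ctr; apply: eq_unif => s sd; by rewrite pad_size.
by exists 0 => j _; apply: IH => d l o; apply: H; exists j.
Qed.

(** A leaf of the cut tree stands for all old leaves above it, so large sets pull back to large sets
    of the uncut tree [cut id id W]. *)
Lemma ctr_cut D h W A B : (forall n, D n <= n) ->
  (forall d l k s, occ W d l -> size s = d k ->
     A (h (l k (pad (d k) (take (D (d k)) s)))) -> B (l k s)) ->
  ctr (cut D h W) A -> ctr (cut id id W) B.
Proof.
move=> Dle; elim: W => [d l H|w IH H] /= [N NP].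
  exists N => k /NP; apply: ctr_unif_take; first exact: Dle.
  move=> s sd; rewrite (pad_size sd).
  exact: (H d l k s (conj erefl erefl) sd).
exists N => j /NP; apply: IH => d l k s o sd; apply: H sd; by exists j.
Qed.

Lemma tree_standard T : mono_tree T -> ole oomega (rk T) -> exists W,
  [/\ wf_itree W, oeq (irk W) (rk T), isupp W `<=` supp T
    & forall A, ctr (cut id id W) A -> ctr T A].
Proof.
elim: T => [x _ //|t IH] wT wr; have [wt dis tm] := wT.
(* Either some child has infinite rank, and by monotonicity so have all later ones, or every child
   has finite rank and the node has rank exactly omega. *)
have [[k0 k0P]|nk] := pselect (exists k, ole oomega (rk (t k))).
  have /choice[w wP] k := IH (k0 + k) (wt _) (ole_trans k0P (tm _ _ (leq_addr k k0))).
  exists (INode w); split=> /=.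
  - split=> [j|i j x|i j ij]; first by have [] := wP j.
    + have [_ _ si _] := wP i; have [_ _ sj _] := wP j.
      by move=> /si + /sj => /dis/[apply]/addnI.
    + have [_ [ri _] _ _] := wP i; have [_ [_ rj] _ _] := wP j.
      by apply: ole_trans ri (ole_trans (tm _ _ _) rj); rewrite leq_add2l.
  - split; apply: olsup_mono => j.
      by exists (k0 + j); have [_ [] ] := wP j.
    exists j; have [_ [_ rj] _ _] := wP j; apply: ole_trans rj.
    by apply: tm; rewrite leq_addl.
  - move=> x [d [l [k [s [[j o] sd lx]]]]]; exists (k0 + j).
    by have [_ _ sj _] := wP j; apply: sj; exists d, l, k, s.
  - move=> A [N NP]; exists (k0 + N) => k Nk.
    have [_ _ _] := wP (k - k0); rewrite subnKC; last by lia.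
    by apply; apply: NP; lia.
have /choice[rho rhoP] k : exists n, ole (ofin n) (rk (t k)) /\ olt (rk (t k)) (ofin n.+1).
  by apply: ofin_floor => tw; apply: nk; exists k.
have rho_le n k : ole (ofin n) (rk (t k)) -> n <= rho k.
  move=> nk'; rewrite leqNgt; apply/negP => /ofin_le kn.
  exact: olt_irrefl (olt_le_trans (rhoP k).2 (ole_trans kn nk')).
have rhom i j : i <= j -> rho i <= rho j.
  by move=> ij; apply: rho_le; apply: ole_trans (rhoP i).1 (tm _ _ ij).
have wr' n : exists k, ole (ofin n) (rk (t k)) := wr n.
(* Dropping the first [k0] children makes all heights positive, as [tree_unif] demands. *)
have [k0 k0P] : exists k, 0 < rho k by have [k /(rho_le 1)] := wr' 1; exists k.
pose d k := rho (k0 + k).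
have dpos k : 0 < d k by apply: leq_trans k0P (rhom _ _ (leq_addr _ _)).
have /choice[l lP] k : exists l,
    [/\ forall s s', size s = d k -> size s' = d k -> l s = l s' -> s = s',
        forall s, size s = d k -> supp (t (k0 + k)) (l s)
      & forall A, ctr (unif (d k) l) A -> ctr (t (k0 + k)) A].
  have := @tree_unif (d k).-1 (t (k0 + k)) (wt _); rewrite prednK //; apply.
  exact: (rhoP _).1.
exists (Om d l); split=> /=.
- split=> // [i j ij|n|k k' s s' sd s'd E].
  + by apply: rhom; rewrite leq_add2l.
  + have [k /rho_le nk'] := wr' n; exists k; apply: leq_trans nk' (rhom _ _ _).
    exact: leq_addl.
  + have [li lS _] := lP k; have kk' : k = k'.
      apply/(@addnI k0)/(dis _ _ (l k s)); first exact: lS.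
      by rewrite E; have [_ lS' _] := lP k'; apply: lS'.
    by subst k'; split=> //; apply: li.
- split=> //; apply: olsup_le => k.
  exact: olt_le_trans (rhoP k).2 (oltW (ofin_lt_omega _)).
- move=> x [_ [_ [k [s [[<- <-] sd <-]]]]]; exists (k0 + k).
  by have [_ lS _] := lP k; apply: lS.
- move=> A [N NP]; exists (k0 + N) => k Nk.
  have [_ _ lA] := lP (k - k0); rewrite subnKC in lA; last by lia.
  apply: lA; have := NP (k - k0); rewrite leq_subRL; last by lia.
  move=> /(_ Nk); congr ctr; apply: eq_unif => s sd; by rewrite pad_size.
Qed.

(** * The collapsing function *)

(* [trunc x m] is the leftmost leaf above the node of depth m below the leaf x. *)
Lemma itree_coding W : wf_itree W -> exists (height : nat -> nat) (trunc : nat -> nat -> nat),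
  forall d l k s, occ W d l -> size s = d k ->
    height (l k s) = d k /\ forall m, trunc (l k s) m = l k (pad (d k) (take m s)).
Proof.
(* The code is chosen for each integer [x] separately: [occ_inj] makes it independent of how [x] is
   written as a label, and integers outside [isupp W] get a dummy value. *)
move=> wf; suff /choice[c cP] : forall x, exists p : nat * (nat -> nat),
    forall d l k s, occ W d l -> size s = d k -> l k s = x ->
      p.1 = d k /\ forall m, p.2 m = l k (pad (d k) (take m s)).
  exists (fun x => (c x).1), (fun x => (c x).2) => d l k s o sd.
  exact: cP o sd erefl.
move=> x; have [[d [l [k [s [o sd lx]]]]]|nx] := pselect (isupp W x).
  exists (d k, fun m => l k (pad (d k) (take m s))) => d' l' k' s' o' sd' lx'.
  have [] := occ_inj wf o o' sd sd' (etrans lx (esym lx')).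
  by move=> -> -> -> ->.
by exists (0, fun=> 0) => d l k s o sd lx; case: nx; exists d, l, k, s.
Qed.

Section Collapse.
Variables (e : bool) (W : itree) (height : nat -> nat) (trunc : nat -> nat -> nat).
Hypothesis wfW : wf_itree W.
Hypothesis codeW : forall d l k s, occ W d l -> size s = d k ->
  height (l k s) = d k /\ forall m, trunc (l k s) m = l k (pad (d k) (take m s)).

(* The name of the node of depth m below the leaf y; only the leftmost leaf
   above a node is used as y, which makes the name unique. *)
Definition name (y m : nat) : nat := e + (pickle (y, m)).*2.

Definition unname (x : nat) : option (nat * nat) := unpickle x./2.

Lemma nameK y m : unname (name y m) = Some (y, m).
Proof.
rewrite /unname /name; have -> : (e + (pickle (y, m)).*2)./2 = pickle (y, m).
  by case: (e) => /=; rewrite ?uphalf_double ?doubleK.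
exact: pickleK.
Qed.

Lemma odd_name y m : odd (name y m) = e.
Proof. by rewrite /name oddD odd_double addbF; case: (e). Qed.

Lemma name_inj y m y' m' : name y m = name y' m' -> y = y' /\ m = m'.
Proof. by move=> /(congr1 unname); rewrite !nameK => -[]. Qed.

(* In a branch of height d, every node of depth > d/2 moves to its immediate
   predecessor. *)
Definition collapse (x : nat) : nat :=
  if odd x == e then
    if unname x is Some (y, m) then
      if (height y)./2 < m then name (trunc y m.-1) m.-1 else x
    else x
  else name (trunc x (height x).-1) (height x).-1.

Lemma collapse_name y m : collapse (name y m) =
  if (height y)./2 < m then name (trunc y m.-1) m.-1 else name y m.
Proof. by rewrite /collapse odd_name eqxx nameK. Qed.

Lemma isupp_height x : isupp W x -> 0 < height x.
Proof.
move=> [d [l [k [s [o sd <-]]]]]; have [-> _] := codeW o sd.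
by have [_ _ dpos _] := occ_wf wfW o.
Qed.

Lemma height_trunc x m : isupp W x -> m <= height x -> height (trunc x m) = height x.
Proof.
move=> [d [l [k [s [o sd <-]]]]]; have [-> ->] := codeW o sd => md.
have sp : size (pad (d k) (take m s)) = d k.
  by rewrite size_pad // size_take_min geq_min sd leqnn orbT.
by have [-> _] := codeW o sp.
Qed.

(** Padding after depth [m] does not alter the first [m'] entries of an address. *)
Lemma trunc_trunc x m m' : isupp W x -> m' <= m -> m <= height x ->
  trunc (trunc x m) m' = trunc x m'.
Proof.
move=> [d [l [k [s [o sd <-]]]]]; have [-> tr] := codeW o sd => mm md.
have sp : size (pad (d k) (take m s)) = d k.
  by rewrite size_pad // size_take_min geq_min sd leqnn orbT.
have [_ tr'] := codeW o sp; rewrite !tr tr' take_pad ?take_takel //.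
by rewrite size_takel // sd.
Qed.

Definition level (n d : nat) : nat := maxn (d - n) d./2.

(** The count starts at one step because an unmoved leaf carries its own label rather than a name.
    Labels of parity [e] are left out, as they could be mistaken for names. *)
Lemma iter_collapse n x : isupp W x -> odd x != e ->
  iter n.+1 collapse x = name (trunc x (level n.+1 (height x))) (level n.+1 (height x)).
Proof.
move=> xW xe; have hx := isupp_height xW; elim: n => [|n IH].
  rewrite /= /collapse (negbTE xe) /level.
  by have -> : maxn (height x - 1) (height x)./2 = (height x).-1 by lia.
rewrite iterS IH collapse_name height_trunc //; last by rewrite /level; lia.
case: ifP => hl; last first.
  have -> // : level n.+2 (height x) = level n.+1 (height x).
  by rewrite /level in hl *; lia.
have -> : level n.+2 (height x) = (level n.+1 (height x)).-1.
  by rewrite /level in hl *; lia.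
by rewrite trunc_trunc // /level; lia.
Qed.

(** A point is fixed or moves to a name, and each further move lowers the depth stored in the
    name. *)
Lemma iter_collapse_stationary x : exists N, forall n, N <= n ->
  iter n collapse x = iter N collapse x.
Proof.
suff H m y : exists N, forall n, N <= n ->
    iter n collapse (name y m) = iter N collapse (name y m).
  have [cx|[y [m cx]]] : collapse x = x \/ exists y m, collapse x = name y m.
    rewrite /collapse; case: ifP => _; last by right; do 2!eexists.
    case: (unname x) => [[y m]|]; last by left.
    by case: ifP => _; [right; do 2!eexists|left].
  - by exists 0 => n _; apply: iter_fix.
  - have [N NP] := H m y; exists N.+1 => -[//|n] Nn.
    by rewrite !iterSr cx; apply: NP.
elim/ltn_ind: m y => m IH y; have [hm|hm] := ltnP (height y)./2 m; last first.
  by exists 0 => n _; apply: iter_fix; rewrite collapse_name ltnNge hm.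
have [|N NP] := IH m.-1 _ (trunc y m.-1); first by lia.
exists N.+1 => -[//|n] Nn; rewrite !iterSr collapse_name hm; exact: NP.
Qed.

Variable u : set_system nat.
Hypothesis uu : UltraFilter u.
Hypothesis ue : ~ u (parity e).
Hypothesis Wu : forall A, ctr (cut id id W) A -> u A.

Lemma u_not_parity : u (~` parity e).
Proof. by have [] := in_ultra_setVsetC (F := u) (parity e) uu. Qed.

(** Serves the iterates with [D] equal to [level n.+1] and the limit with [D] equal to [half]: the
    witness is the tree cut at depth [D], its leaves labelled by names. *)
Lemma has_contour_collapse (D H : nat -> nat) : {homo D : m n / m <= n} ->
  (forall n, D n <= n) -> (forall n, exists m, n <= D m) ->
  (forall x, isupp W x -> odd x != e ->
     H x = name (trunc x (D (height x))) (D (height x))) ->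
  has_contour (irk W) (fmap H u).
Proof.
move=> Dm Dle Dub HE; pose h y := name y (D (height y)).
have hi : injective h by move=> y y' /name_inj[].
have [wT rT _] := cut_mono Dm Dle Dub hi wfW.
exists (cut D h W); split=> // A hA.
(* [H] is controlled only off the parity class, which can be added freely since it is not in [u]. *)
suff uH : u (parity e `|` H @^-1` A).
  by apply: ultra_sub uu u_not_parity uH _ => x nx [/nx|].
apply: Wu; apply: ctr_cut hA => // d l k s o sd hA.
have [xe|xe] := eqVneq (odd (l k s)) e; [by left|right].
have xW : isupp W (l k s) by exists d, l, k, s.
rewrite /preimage /= HE //; have [hx tx] := codeW o sd; move: hA.
by rewrite /h hx tx -tx height_trunc ?hx.
Qed.

(** Above a node [n.+1] levels below the leaves, [n] steps still separate the children while one
    more step merges them. A finite fibre in [U] therefore meets only finitely many children, and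
    the contour excludes [V] from [u]. *)
Lemma collapse_not_finite_to_one n (U : set nat) :
  fmap (iter n collapse) u U -> ~ finite_to_one_on U (iter n.+1 collapse).
Proof.
move=> uU Ufin; pose V := [set x | odd x <> e /\ U (iter n collapse x)].
have uV : u V.
  by apply: ultra_sub uu u_not_parity uU _ => x.
suff nV : ctr (cut id id W) (~` V).
  exact: ultra_disjoint uu uV (Wu nV) (fun x Vx nVx => nVx Vx).
apply: ctr_cut_id => d l o; have [dm dub dpos li] := occ_wf wfW o.
(* This height gives [d k - n.+1 >= (d k)./2], so the first [n.+1] steps are not stopped at half
   height. *)
have [N NP] := dub (2 * n).+2; exists N => k Nk.
have dk : (2 * n).+2 <= d k := leq_trans NP (dm _ _ Nk).
pose q := d k - n.+1.
have dq : d k = q + n.+1 by rewrite subnK //; lia.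
rewrite dq; apply: ctr_unif_level => s sq.
pose X i s' := l k (s ++ i :: s').
have Xsize i s' : size s' = n -> size (s ++ i :: s') = d k.
  by move=> s'n; rewrite size_cat /= sq s'n -dq.
have XW i s' : size s' = n -> isupp W (X i s').
  by move=> s'n; exists d, l, k, (s ++ i :: s'); split=> //; apply: Xsize.
have Xh i s' : size s' = n -> height (X i s') = d k.
  by move=> s'n; have [] := codeW o (Xsize i s' s'n).
have Xlow i s' : size s' = n -> odd (X i s') != e ->
    iter n.+1 collapse (X i s') = name (l k (pad (d k) s)) q.
  move=> s'n Xe; rewrite iter_collapse ?Xh //; last exact: XW.
  have -> : level n.+1 (d k) = q by rewrite /level /q; lia.
  by have [_ ->] := codeW o (Xsize i s' s'n); rewrite take_size_cat.
have Xinj i j s' s'' : size s' = n -> size s'' = n -> odd (X i s') != e ->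
    odd (X j s'') != e -> iter n collapse (X i s') = iter n collapse (X j s'') -> i = j.
  (* With no step made the points are still leaf labels, not names, and injectivity of the labelling
     is used directly. *)
  move=> s'n s''n ie je; case: (posnP n) => [n0|n0].
    move=> /=; rewrite n0 /= => E; have [] := li _ _ _ _ _ _ E; rewrite ?Xsize //.
    by move=> _ /eqP; rewrite eqseq_cat // eqxx => /eqP[].
  rewrite -(prednK n0) !iter_collapse ?Xh //; try exact: XW.
  rewrite prednK //; have -> : level n (d k) = q.+1 by rewrite /level /q; lia.
  move=> /name_inj[+ _].
  have [_ ->] := codeW o (Xsize i s' s'n); have [_ ->] := codeW o (Xsize j s'' s''n).
  have tk a r : take q.+1 (s ++ a :: r) = rcons s a.
    by rewrite take_cat sq ltnNge leqnSn /= subSnn /= take0 cats1.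
  rewrite !tk => E; have [] := li _ _ _ _ _ _ E; rewrite ?size_pad ?size_rcons ?sq //; try lia.
  by move=> _ /pad_inj; rewrite !size_rcons => /(_ erefl)/rcons_inj[].
(* For every leaf above [s] off the parity class, [n] steps followed by [n.+1] more lead to [m]: the
   first [n.+1] of them reach the node, the other [n] act on its name. *)
pose m := iter n collapse (name (l k (pad (d k) s)) q).
have [|M MP] := finite_eventually (Ufin m) (P := fun y i => forall s', size s' = n ->
    odd (X i s') != e -> iter n collapse (X i s') <> y).
  move=> y _; have [[j [s' [s'n je jy]]]|nj] := pselect (exists j s',
      [/\ size s' = n, odd (X j s') != e & iter n collapse (X j s') = y]).
    exists j.+1 => i ji s'' s''n ie iy.
    by have := Xinj _ _ _ _ s''n s'n ie je (etrans iy (esym jy)) => ij; rewrite ij ltnn in ji.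
  by exists 0 => i _ s' s'n ie iy; apply: nj; exists i, s'.
exists M => i Mi s' s'n [/eqP ie Ui].
apply: (MP i Mi _ _ s' s'n ie erefl); split=> //.
by rewrite /preimage /mkset -iterD addSnnS iterD Xlow.
Qed.

End Collapse.

(** * Iterates and pointwise limit of the collapsing function *)

Lemma ultra_fmap (h : nat -> nat) (u : set_system nat) :
  UltraFilter u -> UltraFilter (fmap h u).
Proof.
move=> uu; have pu : ProperFilter u := @ultra_proper _ _ uu.
split=> [|G GP hG]; first exact: fmap_proper_filter.
apply/seteqP; split=> // A GA.
have [//|nA] := in_ultra_setVsetC (F := u) (h @^-1` A) uu.
by case: (@filter_not_empty _ G GP); apply: filterS (filterI GA (hG (~` A) nA)) => x [].
Qed.

Theorem theorem3p6 (alpha : cord) (alpha_infinite : ole oomega alpha)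
    (alpha_succ : exists beta : cord, oeq alpha (osucc beta))
    (u : set_system nat) (Pu : P_class alpha u) :
  exists f : nat -> nat,
    (forall (n : nat) (U : set nat), (1 <= n)%N ->
       fmap (iter n.-1 f) u U -> ~ finite_to_one_on U (iter n f)) /\
    exists g : nat -> nat,
      ptws_limit (fun n => iter n f) g /\
      (forall n : nat, P_class alpha (fmap (iter n f) u)) /\
      P_class alpha (fmap g u).
Proof.
have [beta [ab ba]] := alpha_succ.
have [uu nalpha ualpha] := (P_classP _ _).1 Pu.
have wbeta : ole oomega beta.
  apply: omega_le => n.
  by have /olt_olsupP[] := olt_le_trans (ofin_lt_omega n) (ole_trans alpha_infinite ab).
have one_beta : ole oone beta := ole_trans (oltW (ofin_lt_omega 1)) wbeta.
have one_alpha : ole oone alpha := ole_trans (oltW (ofin_lt_omega 1)) alpha_infinite.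
have [T [wT Tbeta Tu]] := ualpha beta one_beta ba.
have [W [wfW WT _ WA]] := tree_standard wT (ole_trans wbeta Tbeta.2).
have Wbeta := oeq_trans WT Tbeta.
have Wu A : ctr (cut id id W) A -> u A by move=> /WA /Tu.
have [e ue] := ultra_parity uu.
have [height [trunc codeW]] := itree_coding wfW.
(* Rank [beta] is enough: a contour of rank [alpha] would pull back to [u], and every rank below
   [alpha] is at most [beta]. *)
have PH h : has_contour beta (fmap h u) -> P_class alpha (fmap h u).
  move=> hb; apply/P_classP; split; first exact: ultra_fmap.
  - by move=> /(has_contour_fmap uu ue one_alpha).
  - move=> b b1 /olt_le_trans/(_ ab)/olt_olsupP[_ bb].
    exact: has_contour_le b1 bb hb.
have contour_eq h : has_contour (irk W) (fmap h u) -> has_contour beta (fmap h u).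
  by move=> [T' [? T'W ?]]; exists T'; split=> //; apply: oeq_trans T'W Wbeta.
pose f := collapse e height trunc.
exists f; split.
  move=> [//|n] U _; exact: (collapse_not_finite_to_one wfW codeW uu ue Wu).
have /choice[N NP] := iter_collapse_stationary e height trunc.
pose g x := iter (N x) f x.
exists g; split; [|split].
- by move=> x; exists (N x) => // n /NP.
- case=> [|n]; first exact: Pu.
  apply/PH/contour_eq.
  apply: (has_contour_collapse wfW codeW uu ue Wu (D := level n.+1)).
  + by move=> i j ij; rewrite /level; lia.
  + by move=> i; rewrite /level; lia.
  + by move=> i; exists i.*2; rewrite /level; lia.
  + by move=> x xW xe; apply: (iter_collapse wfW codeW).
- apply/PH/contour_eq.
  apply: (has_contour_collapse wfW codeW uu ue Wu (D := half)).
  + by move=> i j ij; lia.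
  + by move=> i; lia.
  + by move=> i; exists i.*2; lia.
  (* Beyond [N x] the iterates equal [g x], and beyond [height x] steps the level has come down to
     half the height. *)
  + move=> x xW xe; pose n := maxn (N x) (height x).
    have -> : g x = iter n.+1 f x by rewrite NP // ltnW // ltnS leq_maxl.
    rewrite (iter_collapse wfW codeW) //.
    by have -> : level n.+1 (height x) = (height x)./2 by rewrite /level /n; lia.
Qed.
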